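(* Let $f_x(s)$ be a PSIAC kernel of degree $k$ and reproduction degree $r$ with index sequence $\mathcal J=(j_0,\dots,j_r)$ and knot sequence $h t_{0:n}+x-h\lambda$, i.e. for every $x$, $f_x$ is the SIAC spline kernel of reproduction degree $r$ with index sequence $\mathcal J$ over these knots. Let $u(x,\tau)=\sum_{i=0}^m u_i(\tau)\,\phi_i(x;hs_{0:m})$, $x\in[a,b]$, $\tau\ge 0$, be the DG output. Let $\mathcal I$ be the set of indices $i$ of basis functions $\phi_i(\cdot\,;hs_{0:m})$ with support overlapping $h[\lambda-t_n,\lambda-t_0]$. Then the filtered DG approximation $(u*f_x)(x)=\int_{\mathbb R} f_x(s)\,u(x-s,\tau)\,\mathrm ds$ is a polynomial in $x$ of degree $r$ (degree understood as at most $r$): $$\big(u*f_x\big)(x)=\mathbf u_{\mathcal I}\;Q_\lambda\;\operatorname{diag}(1,h^{-1},\dots,h^{-r})\;\big(1,\,x-h\lambda,\,\dots,(x-h\lambda)^r\big)^{\mathsf T},$$ where $\mathbf u_{\mathcal I}:=[u_i(\tau)]_{i\in\mathcal I}$ (row vector), $$Q_\lambda:=G_\lambda\,A\,M_{0,\mathbf t,\mathcal J}^{-1}\,\operatorname{diag}\Big(\big[(-1)^\ell\tbinom{\ell+k+1}{\ell}\big]_{\ell=0,\dots,r}\Big),$$ $$G_\lambda:=\Big[\int_{\lambda-t_n}^{\lambda-t_0}\phi_i(s;s_{0:m})\,B(s\,|\,\lambda-t_{n-j:j_r-j})\,\mathrm ds\Big]_{i\in\mathcal I,\ j\in\mathcal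 J},$$ and $A$ is the reversal matrix ($1$ on the antidiagonal and $0$ elsewhere).
   Context: Notation: $t_{i:j}=(t_i,\dots,t_j)$, with indices descending if $i>j$; operations such as $h t_{i:j}+\xi$ and $\lambda - t_{i:j}$ act entrywise. For a non-decreasing sequence $t_{i:j}$ and sufficiently smooth $g$, divided differences are $\Delta(t_i)g=g(t_i)$ and, for $j>i$, $\Delta(t_{i:j})g=(\Delta(t_{i+1:j})g-\Delta(t_{i:j-1})g)/(t_j-t_i)$ if $t_i\ne t_j$, and $=g^{(j-i)}(t_i)/(j-i)!$ if $t_i=t_j$. B-spline: for knots $t_i\le\dots\le t_{i+k+1}$ (not all equal), $B(x\,|\,t_{i:i+k+1}):=(k+1)\,\Delta(t_{i:i+k+1})\big(\max\{\cdot-x,0\}\big)^k$ is the B-spline of degree $k$ with unit integral (values at knots are immaterial). The knots of every B-spline that occurs are assumed not to be all equal. SIAC spline kernel: let $\mathcal J=(j_0,\dots,j_r)$ be strictly increasing integers with $j_0=0$, let $n=j_r+k+1$, and let $t_{0:n}$ be non-decreasing real knots. The SIAC spline kernel of degree $k$ and reproduction degree $r$ with index sequence $\mathcal J$ and knots $t_{0:n}$ is the spline $f=\sum_{j\in\mathcal J} f_{j}\,B(\cdot\,|\,t_{j:j+k+1})$ whose coefficients are such that $\big(f*(-\cdot)^\delta\big)(x)=(-x)^\delta$ for all $x\in\mathbb R$, $\delta=0,\dots,r$, where $(f*g)(x)=\int_{\mathbb R} f(t)g(x-t)\,\mathrm dt$. Reproduction matrix: $M_{0,\mathbf t,\mathcal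 J}:=\big[\Delta(t_{j:j+k+1})\,x^{k+1+\delta}\big]_{\delta=0,\dots,r,\ j\in\mathcal J}$ (divided difference of the monomial $x\mapsto x^{k+1+\delta}$), an invertible $(r+1)\times(r+1)$ matrix, with $\mathbf t=t_{0:n}$. DG setting: $h>0$, $\lambda\in\mathbb R$, $a=hs_0<\dots<hs_m=b$ are break points. The basis functions $\phi_i(\cdot\,;hs_{0:m})$, $0\le i\le m$, are linearly independent integrable real functions on $[a,b]$, regarded as zero outside $[a,b]$, and satisfy $\phi_i(hx;hs_{0:m})=\phi_i(x;s_{0:m})$. The $u_i(\tau)$ are real-valued.
   Formalization: For asymmetric J the displayed formula is false (e.g. k=0, J=(0,1,3)); it is proved for every J with the columns of G_λ indexed by the reflected sequence j_r−J, and literally, with columns indexed by J, whenever J equals j_r−J. *)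

(* Defs.v *)
From HB Require Import structures.
From mathcomp Require Import all_boot all_order all_algebra.
From mathcomp Require Import all_classical all_reals all_analysis.

Set Implicit Arguments.
Unset Strict Implicit.
Unset Printing Implicit Defensive.

Import Order.TTheory GRing.Theory Num.Theory.
Import numFieldNormedType.Exports.

Local Open Scope classical_set_scope.
Local Open Scope ring_scope.

(* A knot sequence is a function nat -> R of which only an initial segment is
   used. [knots_asc t i] is t_i, t_(i+1), ...; [knots_desc t i] is
   t_i, t_(i-1), ..., i.e. the notation t_{i:j} with i > j. *)
Definition knots_asc (R : realType) (t : nat -> R) (i : nat) : nat -> R :=
  fun c => t (i + c)%N.
Definition knots_desc (R : realType) (t : nat -> R) (i : nat) : nat -> R :=
  fun c => t (i - c)%N.

(* [divdiff d v g] is Delta(v_{0:d}) g for v_0 <= ... <= v_d. *)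
Fixpoint divdiff (R : realType) (d : nat) (v : nat -> R) (g : R -> R) : R :=
  if d is d'.+1 then
    if v 0%N == v d then derive1n d g (v 0%N) / d`!%:R
    else (divdiff d' (knots_asc v 1) g - divdiff d' v g) / (v d - v 0%N)
  else g (v 0%N).

(* max{y, 0}^k, where for k = 0 the usual convention max{y, 0}^0 = 1 if y > 0
   and 0 otherwise is made explicit ([0 ^+ 0 = 1] in the library). *)
Definition trunc_pow (R : realType) (k : nat) (y : R) : R :=
  if 0 < y then y ^+ k else 0.

(* B(x | v_{0:k+1}). At a multiple knot x the derivative in [divdiff] may fail
   to exist; the value there is then a default real number. *)
Definition bspline (R : realType) (k : nat) (v : nat -> R) (x : R) : R :=
  k.+1%:R * divdiff k.+1 v (fun y => trunc_pow k (y - x)).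

Definition convolution (R : realType) (f g : R -> R) (x : R) : R :=
  \int[lebesgue_measure]_s (f s * g (x - s)).

(* The equation for f is imposed off the knots only, where the values of the
   B-splines are meaningful. *)
Definition siac_kernel (R : realType) (k r : nat) (J : 'I_r.+1 -> nat)
    (t : nat -> R) (f : R -> R) : Prop :=
  exists coef : 'I_r.+1 -> R,
    (forall x : R,
       (forall i, (i <= J ord_max + k + 1)%N -> x != t i) ->
       f x = \sum_(c < r.+1) coef c * bspline k (knots_asc t (J c)) x) /\
    (forall (delta : nat) (x : R), (delta <= r)%N ->
       convolution f (fun y => (- y) ^+ delta) x = (- x) ^+ delta).

Definition repro_mx (R : realType) (k r : nat) (t : nat -> R)
    (J : 'I_r.+1 -> nat) : 'M[R]_r.+1 :=
  \matrix_(delta < r.+1, c < r.+1)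
    divdiff k.+1 (knots_asc t (J c)) (fun x => x ^+ (k + 1 + delta)).

Definition reversal_mx (R : realType) (r : nat) : 'M[R]_r.+1 :=
  \matrix_(i < r.+1, j < r.+1) (i + j == r)%N%:R.

(* The index sequence j_r - j_r, j_r - j_(r-1), ..., j_r - j_0. If the splines
   B(. | t_{j:j+k+1}) are those with j in J, then their reflections are the
   B(. | v_{j:j+k+1}) with v_i = lambda - t_(n-i) and j in [reflect_index J],
   again in increasing order. *)
Definition reflect_index (r : nat) (J : 'I_r.+1 -> nat) : 'I_r.+1 -> nat :=
  fun c => (J ord_max - J (rev_ord c))%N.

(* Indices i such that the support of phi i meets [lo, hi]. *)
Definition overlapping (R : realType) (m : nat) (phi : 'I_m.+1 -> R -> R)
    (lo hi : R) : {set 'I_m.+1} :=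
  finset (fun i =>
    `[< closure [set x | phi i x != 0] `&` `[lo, hi] !=set0 >]).

(* G_lambda with rows i in I and columns j in K; psi i is phi_i(.; s_{0:m}),
   and n is the number of the last knot; the knots of column j are
   lambda - t_{n-j:j_r-j}, where j_r - j = n - j - (k + 1). *)
Definition G_mx (R : realType) (k r m n : nat) (lambda : R) (t : nat -> R)
    (psi : 'I_m.+1 -> R -> R) (I : {set 'I_m.+1}) (K : 'I_r.+1 -> nat) :
    'M[R]_(#|I|, r.+1) :=
  \matrix_(i < #|I|, c < r.+1)
    \int[lebesgue_measure]_(s in `[lambda - t n, lambda - t 0%N])
      (psi (enum_val i) s *
       bspline k (fun e => lambda - knots_desc t (n - K c) e) s).

(* Q_lambda, where the columns of G_lambda run over the index sequence K. *)
Definition Q_mx (R : realType) (k r m n : nat) (lambda : R) (t : nat -> R)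
    (psi : 'I_m.+1 -> R -> R) (I : {set 'I_m.+1}) (J K : 'I_r.+1 -> nat) :
    'M[R]_(#|I|, r.+1) :=
  G_mx k n lambda t psi I K *m reversal_mx R r *m invmx (repro_mx k t J) *m
  diag_mx (\row_(l < r.+1) ((-1) ^+ l * 'C(l + k + 1, l)%:R)).

(* u_I Q diag(1, h^-1, ..., h^-r) (1, y, ..., y^r)^T *)
Definition filter_form (R : realType) (r m : nat) (I : {set 'I_m.+1})
    (u : 'I_m.+1 -> R) (Q : 'M[R]_(#|I|, r.+1)) (h y : R) : R :=
  ((\row_(i < #|I|) u (enum_val i)) *m Q *m
   diag_mx (\row_(l < r.+1) h ^- l) *m (\col_(l < r.+1) y ^+ l)) 0 0.

(* Main.v *)
Require Import Defs.
From HB Require Import structures.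
From mathcomp Require Import all_boot all_order all_algebra.
From mathcomp Require Import all_classical all_reals all_analysis.
From mathcomp Require Import measurable_realfun.
From mathcomp Require Import ring lra zify.

Set Implicit Arguments.
Unset Strict Implicit.
Unset Printing Implicit Defensive.

Import Order.TTheory GRing.Theory Num.Theory.
Import numFieldNormedType.Exports.

Local Open Scope classical_set_scope.
Local Open Scope ring_scope.

(** Write a kernel over the knots h * t i + x - h * lambda as a combination of
    B-splines with coefficients c(x). Two observations give the theorem.

    The coefficients are polynomial in y = x - h * lambda. A B-spline of degree
    k is a divided difference of order k + 1 of truncated powers, so its moment
    of order delta about any point L is, up to a binomial coefficient, the
    divided difference of (. - L) ^+ (k + 1 + delta) ([bspline_moment]). At
    L = y the knots minus L are the h * t i, hence that divided difference is
    h ^+ delta times an entry of the reproduction matrix M, and reproduction of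
    polynomials becomes the linear system M c(x) = D (1, y, ..., y^r)^T with D
    diagonal ([kernel_coef_system]). As this system is solvable for every x
    and D is invertible, a Vandermonde matrix factors through M, and M is
    invertible ([unitmx_moment_system]).

    The remaining integrals do not depend on x. The substitution
    y |-> x - h * w carries the B-splines over h * t i + x - h * lambda to those
    over lambda - t i, and u (x - .) to u (h * .) ([filter_substitution]); the
    integrals of these B-splines against the basis functions are the entries of
    G, with the order of the columns reversed.

    The computations rest on the algebra of divided differences. These are
    applied here to jets, i.e. to families (G j) standing for the derivatives of
    a function, because a truncated power has all its derivatives only away from
    its break point, whereas its jet is given by a formula everywhere. The facts
    needed are that divided differences of order d kill polynomials of degree
    below d, and that they are compatible with affine maps and with reversal of
    the knots. B-splines and kernels agree with everywhere defined measurable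
    functions off finitely many knots, which integrals ignore. *)

(** * Divided differences of jets *)

Section JetDivdiff.
Variable R : realType.
Implicit Types (v w : nat -> R) (G H : nat -> R -> R).

(** In a jet G, the function G j stands for the j-th derivative of G 0, but no
    relation between the G j is imposed: divided differences of jets are thus
    linear and commute with integrals without any smoothness. *)
Fixpoint jet_divdiff (d : nat) v G : R :=
  if d is d'.+1 then
    if v 0%N == v d then G d (v 0%N) / d`!%:R
    else (jet_divdiff d' (knots_asc v 1) G - jet_divdiff d' v G) /
         (v d - v 0%N)
  else G 0%N (v 0%N).

Lemma divdiff_jet d v g :
  divdiff d v g = jet_divdiff d v (fun j => derive1n j g).
Proof. by elim: d v => //= d IHd v; rewrite !IHd. Qed.

Lemma eq_jet_divdiff d v w G H :
    (forall e, (e <= d)%N -> v e = w e) ->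
    (forall j e, (j <= d)%N -> (e <= d)%N -> G j (w e) = H j (w e)) ->
  jet_divdiff d v G = jet_divdiff d w H.
Proof.
elim: d v w => [|d IHd] v w vw GH /=; first by rewrite vw// GH.
rewrite !vw// GH//; case: ifP => // _; congr ((_ - _) / _); apply: IHd.
- by move=> e ed; rewrite /knots_asc vw.
- by move=> j e jd ed; rewrite /knots_asc GH// ltnW.
- by move=> e ed; rewrite vw// ltnW.
- by move=> j e jd ed; rewrite GH// ltnW.
Qed.

(** The derivative of highest order occurs only if the end knots coincide. *)
Lemma eq_jet_divdiff_lt d v G H : v 0%N != v d ->
    (forall j e, (j < d)%N -> (e <= d)%N -> G j (v e) = H j (v e)) ->
  jet_divdiff d v G = jet_divdiff d v H.
Proof.
case: d => [|d] /= v0d GH; first by rewrite eqxx in v0d.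
rewrite (negbTE v0d); congr ((_ - _) / _); apply: eq_jet_divdiff => //.
- by move=> j e jd ed; rewrite GH.
- by move=> j e jd ed; rewrite GH// ltnW.
Qed.

Lemma jet_divdiffD d v G H :
  jet_divdiff d v (fun j y => G j y + H j y) =
  jet_divdiff d v G + jet_divdiff d v H.
Proof.
elim: d v => //= d IHd v; rewrite !IHd; case: ifP => _; first by rewrite mulrDl.
by rewrite -mulrDl; congr (_ / _); rewrite opprD addrACA.
Qed.

Lemma jet_divdiffZ d v (a : R) G :
  jet_divdiff d v (fun j y => a * G j y) = a * jet_divdiff d v G.
Proof.
elim: d v => //= d IHd v; rewrite !IHd.
by case: ifP => _; rewrite mulrA// mulrBr.
Qed.

(** No order of the knots is involved, so a may be negative. *)
Lemma jet_divdiff_affine d v (a b : R) G : a != 0 ->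
  jet_divdiff d (fun e => a * v e + b) G =
  a ^- d * jet_divdiff d v (fun j y => a ^+ j * G j (a * y + b)).
Proof.
move=> a0; elim: d v => [|d IHd] v /=; first by rewrite expr0 invr1 !mul1r.
rewrite (inj_eq (addIr b)) (inj_eq (mulfI a0)); case: ifP => _.
  by rewrite -!mulrA mulKf// expf_neq0.
rewrite -[knots_asc _ _]/(fun e => a * knots_asc v 1 e + b) !IHd -mulrBr.
rewrite opprD addrACA subrr addr0 -mulrBr invfM exprSr invfM.
by rewrite -!mulrA; congr (_ * _); rewrite mulrCA.
Qed.

Lemma jet_divdiff_rev d v G :
  jet_divdiff d (fun e => v (d - e)%N) G = jet_divdiff d v G.
Proof.
elim: d v => // d IHd v /=; rewrite subn0 subnn eq_sym.
case: ifP => [/eqP <-//|_].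
rewrite -(IHd (knots_asc v 1)) -[in RHS](IHd v).
rewrite -[v 0%N - v d.+1]opprB invrN mulrN -mulNr opprB; congr ((_ - _) / _).
apply: eq_jet_divdiff => // e ed.
by rewrite /knots_asc add1n -subSn.
Qed.

(** Monotone knots, in either direction, enter only through this property: an
    index range whose end knots coincide consists of a single repeated knot. *)
Definition knots_convex d v :=
  forall i l e, (i <= l <= e)%N -> (e <= d)%N -> v i = v e -> v l = v i.

Lemma knots_convex_shift d v : knots_convex d.+1 v ->
  knots_convex d (knots_asc v 1).
Proof. by move=> cv i l e ile ed; apply: cv; rewrite ?add1n ?ltnS. Qed.

Lemma knots_convexW d d' v : (d' <= d)%N -> knots_convex d v ->
  knots_convex d' v.
Proof. by move=> dd cv i l e ile ed; apply: cv => //; apply: leq_trans dd. Qed.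

Lemma jet_divdiff_const d v G y : (forall e, (e <= d)%N -> v e = y) ->
  jet_divdiff d v G = G d y / d`!%:R.
Proof.
case: d => [|d] vy /=; first by rewrite vy// divr1.
by rewrite !vy// eqxx.
Qed.

(** The recursion of divided differences, multiplied out so that it holds for
    coinciding end knots too. *)
Lemma jet_divdiff_rec d v G : knots_convex d.+1 v ->
  jet_divdiff d (knots_asc v 1) G - jet_divdiff d v G =
  (v d.+1 - v 0%N) * jet_divdiff d.+1 v G.
Proof.
move=> cv /=; case: ifP => [/eqP v0d|/negbT v0d]; last first.
  by rewrite mulrC divfK// subr_eq0 eq_sym.
have vc e : (e <= d.+1)%N -> v e = v 0%N by move=> ed; apply: cv v0d.
rewrite !(@jet_divdiff_const d _ _ (v 0%N)) ?v0d ?subrr ?mul0r// -v0d.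
- by move=> e /leqW; exact: vc.
- by move=> e ed; rewrite /knots_asc vc.
Qed.

(** The Leibniz rule for divided differences, when the other factor is
    y |-> y - a; the jet of the product is the one displayed on the left. *)
Lemma jet_divdiff_mulX d v (a : R) G : knots_convex d.+1 v ->
  jet_divdiff d.+1 v (fun j y => (y - a) * G j y + j%:R * G j.-1 y) =
  (v 0%N - a) * jet_divdiff d.+1 v G + jet_divdiff d (knots_asc v 1) G.
Proof.
elim: d v => [|d IHd] v cv.
  rewrite /= /knots_asc /= !mul0r !addr0 !divr1 !mul1r.
  case: ifP => [/eqP->//|/negbT v01].
  have : v 1%N - v 0%N != 0 by rewrite subr_eq0 eq_sym.
  by move=> v10; field.
have [vd|v0d] := eqVneq (v 0%N) (v d.+2).
  have vc e : (e <= d.+2)%N -> v e = v 0%N by move=> ed; apply: cv vd.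
  rewrite !(@jet_divdiff_const d.+2 v _ (v 0%N))//.
  rewrite (@jet_divdiff_const d.+1 (knots_asc v 1) _ (v 0%N)); last first.
    by move=> e ed; rewrite /knots_asc vc.
  rewrite mulrDl -mulrA; congr (_ + _).
  by rewrite [d.+2`!]factS natrM invfM mulrACA divff ?pnatr_eq0// mul1r.
have cvs := knots_convex_shift cv.
have cvW := knots_convexW (leqnSn _) cv.
have vd0 : v d.+2 - v 0%N != 0 by rewrite subr_eq0 eq_sym.
have recv := jet_divdiff_rec G cv.
apply: (mulfI vd0); rewrite -jet_divdiff_rec// !IHd// mulrDr mulrCA -recv.
have -> : jet_divdiff d (knots_asc (knots_asc v 1) 1) G =
    jet_divdiff d (knots_asc v 1) G +
    (v d.+2 - v 1%N) * jet_divdiff d.+1 (knots_asc v 1) G.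
  by rewrite -[_ * _](jet_divdiff_rec G cvs) addrC subrK.
rewrite -[knots_asc v 1 0%N]/(v 1%N).
move: (jet_divdiff d.+1 _ G) (jet_divdiff d.+1 v G) (jet_divdiff d _ G).
by move=> X Y Z; ring.
Qed.

(** The jet of y |-> (y - a) ^+ N. *)
Definition pow_jet (N : nat) (a : R) : nat -> R -> R :=
  fun j y => (N ^_ j)%:R * (y - a) ^+ (N - j).

Lemma pow_jetS N a j y :
  pow_jet N.+1 a j y = (y - a) * pow_jet N a j y + j%:R * pow_jet N a j.-1 y.
Proof.
rewrite /pow_jet; case: j => [|j].
  by rewrite !ffactn0 !subn0 mul0r addr0 !mul1r exprS.
rewrite ffactSS ffactnSr subSS /=; have [jN|Nj|<-] := ltngtP j N.
- rewrite mulrCA -exprS subnSK// !mulrA -mulrDl -natrM -natrD mulnC.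
  by congr (_%:R * _); rewrite [(j.+1 * _)%N]mulnC -mulnDr addnS subnK// ltnW.
- by rewrite ffact_small// muln0 mul0n !mul0r !mulr0 addr0.
- rewrite !subnn muln0 mul0r mulr0 add0r !expr0 natrM; ring.
Qed.

Lemma jet_divdiff_cst d v a : jet_divdiff d.+1 v (pow_jet 0 a) = 0.
Proof.
have jet0 j y : pow_jet 0 a j.+1 y = 0 by rewrite /pow_jet ffact_small// mul0r.
elim: d v => [|d IHd] v.
  rewrite /= jet0 mul0r; case: ifP => // _.
  by rewrite /pow_jet !ffactn0 !expr0 subrr mul0r.
rewrite -[LHS]/(if v 0%N == v d.+2 then pow_jet 0 a d.+2 (v 0%N) / d.+2`!%:R
  else (jet_divdiff d.+1 (knots_asc v 1) (pow_jet 0 a) -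
        jet_divdiff d.+1 v (pow_jet 0 a)) / (v d.+2 - v 0%N)).
by rewrite !IHd jet0 subrr !mul0r if_same.
Qed.

(** By the Leibniz rule, each factor y - a can be removed at the cost of at most
    one order, so a difference of positive order of a constant remains. *)
Lemma jet_divdiff_pow_small d v N a : knots_convex d v -> (N < d)%N ->
  jet_divdiff d v (pow_jet N a) = 0.
Proof.
elim: N d v => [|N IHN] [|d] v cv // Nd; first exact: jet_divdiff_cst.
rewrite (@eq_jet_divdiff _ _ v _
  (fun j y => (y - a) * pow_jet N a j y + j%:R * pow_jet N a j.-1 y)) //.
- rewrite jet_divdiff_mulX// !IHN ?mulr0 ?addr0// 1?ltnW//.
  exact: knots_convex_shift.
- by move=> j e _ _; rewrite pow_jetS.
Qed.

(** * Smooth jets and truncated powers *)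

Lemma derive1n_shift_exp N a j :
  derive1n j (fun y : R => (y - a) ^+ N) = pow_jet N a j.
Proof.
pose p i : {poly R} := (N ^_ i)%:R *: ('X - a%:P) ^+ (N - i).
have pE i : pow_jet N a i = horner (p i).
  by apply/funext => y; rewrite /p !hornerE.
elim: j => [|j IHj].
  by apply/funext => y; rewrite derive1n0 /pow_jet ffactn0 mul1r subn0.
rewrite derive1nS IHj !pE -derivE; congr horner.
rewrite /p derivZ deriv_exp derivXsubC mul1r -scalerMnr scalerMnl -mulrnA.
by rewrite -ffactnSr subnS.
Qed.

Lemma near_eq_derive1n (f g : R -> R) (a : R) j :
  (\forall y \near a, f y = g y) ->
  \forall y \near a, derive1n j f y = derive1n j g y.
Proof.
move=> fg; elim: j => // j IHj.
move/near_join: IHj; apply: filterS => x fgx.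
by rewrite !derive1nS !derive1E; exact: near_eq_derive.
Qed.

Lemma eq_near_derive1n (f g : R -> R) (a : R) j :
  (\forall y \near a, f y = g y) -> derive1n j f a = derive1n j g a.
Proof. by move=> /near_eq_derive1n-/(_ j)/nbhs_singleton. Qed.

(** The jet of the truncated power y |-> max(y - x, 0) ^+ k away from y = x. *)
Definition trunc_jet (k : nat) (x : R) : nat -> R -> R :=
  fun j y => (k ^_ j)%:R * trunc_pow (k - j) (y - x).

Lemma derive1n_trunc_pow k x j y : x != y ->
  derive1n j (fun y => trunc_pow k (y - x)) y = trunc_jet k x j y.
Proof.
rewrite neq_lt /trunc_jet /trunc_pow subr_gt0 => /orP[xy|yx].
  rewrite xy -[RHS]/(pow_jet k x j y) -derive1n_shift_exp.
  apply: eq_near_derive1n.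
  near=> z; rewrite subr_gt0 ifT//; near: z; exact: lt_nbhsr.
rewrite ltNge ltW// mulr0.
transitivity (derive1n j (fun=> 0 : R) y).
  apply: eq_near_derive1n.
  near=> z; rewrite subr_gt0 ifN// -leNgt ltW//; near: z; exact: lt_nbhsl.
suff -> : derive1n j (fun=> 0 : R) = fun=> 0 by [].
elim: j => // j IHj; rewrite derive1nS IHj; apply/funext => z.
exact: derive1_cst.
Unshelve. all: by end_near. Qed.

End JetDivdiff.

(** * B-splines as divided differences of jets *)

Section JetBspline.
Variables (R : realType) (k : nat).
Implicit Types (v : nat -> R) (x y L : R).

(** The B-spline with the derivatives of the truncated power replaced by their
    formulas, which makes sense at the knots too. *)
Definition jet_bspline v x : R :=
  k.+1%:R * jet_divdiff k.+1 v (trunc_jet k x).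

Lemma eq_bspline v w x : (forall e, (e <= k.+1)%N -> v e = w e) ->
  bspline k v x = bspline k w x.
Proof.
move=> vw; rewrite /bspline !divdiff_jet; congr (_ * _).
exact: eq_jet_divdiff.
Qed.

Lemma bspline_off_knots v x : (forall e, (e <= k.+1)%N -> x != v e) ->
  bspline k v x = jet_bspline v x.
Proof.
move=> xv; rewrite /bspline divdiff_jet /jet_bspline; congr (_ * _).
by apply: eq_jet_divdiff => // j e jk ek; rewrite derive1n_trunc_pow ?xv.
Qed.

Lemma jet_bspline_gt v x : (forall e, (e <= k.+1)%N -> v e < x) ->
  jet_bspline v x = 0.
Proof.
move=> vx; rewrite /jet_bspline -[RHS](mulr0 k.+1%:R); congr (_ * _).
rewrite -[RHS](mul0r (jet_divdiff k.+1 v (trunc_jet k x))) -jet_divdiffZ.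
apply: eq_jet_divdiff => // j e _ ek; rewrite mul0r /trunc_jet /trunc_pow.
by rewrite subr_gt0 ltNge ltW ?vx// mulr0.
Qed.

(** To the left of all knots the truncated power is a polynomial of degree k at
    the knots, which the divided difference kills. *)
Lemma jet_bspline_lt v x : knots_convex k.+1 v ->
  (forall e, (e <= k.+1)%N -> x < v e) -> jet_bspline v x = 0.
Proof.
move=> cv xv; rewrite /jet_bspline -[RHS](mulr0 k.+1%:R); congr (_ * _).
rewrite -(@jet_divdiff_pow_small _ k.+1 v k x cv)//.
apply: eq_jet_divdiff => // j e _ ek.
by rewrite /trunc_jet /trunc_pow subr_gt0 xv.
Qed.

Lemma jet_bspline_outside v (lo hi x : R) : knots_convex k.+1 v ->
    (forall e, (e <= k.+1)%N -> lo <= v e <= hi) -> ~~ (lo <= x <= hi) ->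
  jet_bspline v x = 0.
Proof.
move=> cv vlohi; rewrite negb_and -!ltNge => /orP[xlo|hix].
- apply: jet_bspline_lt => // e ek.
  by apply: lt_le_trans xlo _; have /andP[] := vlohi e ek.
- apply: jet_bspline_gt => e ek.
  by apply: le_lt_trans hix; have /andP[] := vlohi e ek.
Qed.

Lemma jet_bspline_rev v :
  jet_bspline (fun e => v (k.+1 - e)%N) = jet_bspline v.
Proof. by apply/funext => x; rewrite /jet_bspline jet_divdiff_rev. Qed.

(** Reflection turns y |-> max(y - x, 0)^k into max(x - y, 0)^k, and the two
    differ, up to sign, by the polynomial (y - x)^k of degree k, which the
    divided difference kills. At a knot equal to w the case j = k breaks this
    identity. *)
Lemma jet_bspline_reflect v h x w : 0 < h -> knots_convex k.+1 v ->
    (forall e, (e <= k.+1)%N -> w != v e) ->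
  jet_bspline (fun e => x - h * v e) (x - h * w) = h^-1 * jet_bspline v w.
Proof.
move=> h0 cv wv; have hn0 : - h != 0 by rewrite oppr_eq0 gt_eqF.
have h_neq0 : h != 0 by rewrite gt_eqF.
rewrite /jet_bspline mulrCA; congr (_ * _).
transitivity (jet_divdiff k.+1 (fun e => - h * v e + x)
  (trunc_jet k (x - h * w))).
  by apply: eq_jet_divdiff => // e _; rewrite addrC mulNr.
rewrite jet_divdiff_affine//.
transitivity ((- h) ^- k.+1 * jet_divdiff k.+1 v (fun j y =>
    (- h) ^+ k * (pow_jet k w j y + (- 1) * trunc_jet k w j y))).
  congr (_ * _); apply: eq_jet_divdiff => // j e jk ek.
  rewrite /trunc_jet /trunc_pow /pow_jet mulN1r -mulrBr.
  rewrite (_ : _ - _ = - h * (v e - w)); last by ring.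
  rewrite [RHS]mulrCA [LHS]mulrCA.
  have [kj|jk'] := ltnP k j; first by rewrite ffact_small// !mul0r.
  congr (_ * _); rewrite mulNr oppr_gt0 pmulr_rlt0// subr_lt0 subr_gt0 -mulNr.
  have [vw|wv'|/eqP] := ltgtP (v e) w; last first.
    by rewrite eq_sym (negbTE (wv _ ek)).
  - by rewrite subrr !mulr0.
  - by rewrite subr0 exprMn mulrA -exprD subnKC.
rewrite jet_divdiffZ jet_divdiffD jet_divdiffZ jet_divdiff_pow_small// add0r.
have hk0 : (- h) ^+ k != 0 by rewrite expf_neq0.
by rewrite exprS; field; rewrite h_neq0.
Qed.

(** The oriented indicator of the interval from L to y: it is 1 on [L, y[ if
    L <= y, and -1 on [y, L[ otherwise. *)
Definition oriented_itv L y x : R := (x < y)%R%:R - (x < L)%R%:R.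

(** [trunc_jet] minus, for x < L, the jet of (y - x) ^+ k; as a function of x
    it is supported between L and y. *)
Definition kernel_jet L x : nat -> R -> R :=
  fun j y => (k ^_ j)%:R * (oriented_itv L y x * (y - x) ^+ (k - j)).

(** Cutting the truncated power off at an arbitrary L changes it by a
    polynomial of degree k in y. *)
Lemma jet_bspline_kernel v L x : knots_convex k.+1 v ->
  jet_bspline v x = k.+1%:R * jet_divdiff k.+1 v (kernel_jet L x).
Proof.
move=> cv; congr (_ * _).
rewrite -[RHS]addr0 -[in RHS](mulr0 (x < L)%R%:R).
rewrite -(@jet_divdiff_pow_small _ k.+1 v k x cv)// -jet_divdiffZ -jet_divdiffD.
apply: eq_jet_divdiff => // j e _ _.
rewrite /trunc_jet /kernel_jet /pow_jet /trunc_pow /oriented_itv subr_gt0.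
by case: (x < v e); case: (x < L) => /=; ring.
Qed.

End JetBspline.

(** * Integration on the real line *)

Section RealIntegration.
Variable R : realType.
Implicit Types (f g : R -> R) (x y L : R).
Local Notation mu := (@lebesgue_measure R).
Local Notation rintegrable f := (mu.-integrable setT (EFin \o f)).

Lemma rintegrableD f g : rintegrable f -> rintegrable g ->
  rintegrable (fun x => f x + g x).
Proof. by move=> intf intg; have := integrableD measurableT intf intg. Qed.

Lemma rintegrableZ (a : R) f : rintegrable f -> rintegrable (fun x => a * f x).
Proof. by move=> intf; have := integrableZl measurableT a intf. Qed.

Lemma rintegrable0 : rintegrable (fun=> 0 : R).
Proof. exact: integrable0. Qed.

Lemma rintegrable_sum n (F : 'I_n -> R -> R) :
    (forall i, rintegrable (F i)) ->
  rintegrable (fun x => \sum_(i < n) F i x).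
Proof.
elim: n F => [|n IHn] F intF.
  by under eq_fun do rewrite big_ord0; exact: rintegrable0.
under eq_fun do rewrite big_ord_recr; apply: rintegrableD => //.
by apply: IHn => i; exact: intF.
Qed.

Lemma Rintegral_sum n (F : 'I_n -> R -> R) :
    (forall i, rintegrable (F i)) ->
  \int[mu]_x (\sum_(i < n) F i x) = \sum_(i < n) \int[mu]_x F i x.
Proof.
elim: n F => [|n IHn] F intF.
  under eq_Rintegral do rewrite big_ord0.
  by rewrite big_ord0 /Rintegral integral0.
under eq_Rintegral do rewrite big_ord_recr.
rewrite RintegralD//= ?big_ord_recr/= ?IHn//.
by apply: rintegrable_sum => i; exact: intF.
Qed.

(** Changing a function at finitely many points keeps it measurable: every
    preimage changes by a finite set. *)
Lemma measurable_eq_off_finite (F : set R) (D : set R) f g :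
    finite_set F -> measurable D -> measurable_fun D g ->
    (forall x, ~ F x -> f x = g x) ->
  measurable_fun D f.
Proof.
move=> finF mD mg fg _ Y mY.
have -> : D `&` f @^-1` Y =
    ((D `&` g @^-1` Y) `\` F) `|` ((D `&` f @^-1` Y) `&` F).
  apply/seteqP; split => x /=.
  - move=> [Dx Yfx]; have [Fx|Fx] := pselect (F x); first by right.
    by left; split => //; rewrite -fg.
  - by move=> [[[Dx Ygx] Fx]|[[Dx Yfx] _]]//; rewrite fg.
have mfin (A : set R) : finite_set A -> measurable A.
  move=> finA; apply: countable_measurable; last exact: finite_set_countable.
  by move=> x; exact: measurable_set1.
apply: measurableU.
- by apply: measurableD; [exact: mg|exact: mfin].
- by apply: mfin; apply: finite_setIr.
Qed.

Lemma Rintegral_eq_off_finite (F : set R) (D : set R) f g :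
    finite_set F -> measurable D -> measurable_fun D g ->
    (forall x, ~ F x -> f x = g x) ->
  \int[mu]_(x in D) f x = \int[mu]_(x in D) g x.
Proof.
move=> finF mD mg fg; congr fine; apply: ae_eq_integral => //.
- by apply/measurable_EFinP; apply: measurable_eq_off_finite mg fg.
- exact/measurable_EFinP.
- have F0 : mu.-negligible F.
    exists F; split => //.
    + apply: countable_measurable; last exact: finite_set_countable.
      by move=> x; exact: measurable_set1.
    + by apply: countable_lebesgue_measure0; exact: finite_set_countable.
  apply: negligibleS F0 => x /= /not_implyP[Dx]; apply: contra_notP => Fx.
  by rewrite fg.
Qed.

(** * Affine changes of variables *)

Lemma measurable_reflect (h x : R) :
  measurable_fun [set: R] (fun w : R => x - h * w).
Proof. by apply: measurable_funB => //; apply: measurable_funM. Qed.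

(** The image of Lebesgue measure under w |-> x - h * w, rescaled by the
    Jacobian h so that it is Lebesgue measure again. *)
Definition reflect_measure (h x : R) (h0 : 0 < h) :
    {measure set (measurableTypeR R) -> \bar R} :=
  @mscale _ (measurableTypeR R) R (NngNum (ltW h0))
    (@measure_function_pushforward__canonical__measure_function_Measure
      _ _ (measurableTypeR R) (measurableTypeR R) R mu _
      (@measurable_reflect h x)).

Lemma lebesgue_measure_reflect (h x : R) (h0 : 0 < h) (A : set R) :
  measurable A -> mu A = reflect_measure x h0 A.
Proof.
apply: (@lebesgue_measure_unique R (reflect_measure x h0)) => _ [[a b] _ <-].
rewrite /reflect_measure /= /mscale /= /pushforward.
rewrite (_ : _ @^-1` _ = [set` `[(x - b) / h, (x - a) / h[]); last first.
  apply/seteqP; split => w /=; rewrite !in_itv/= ler_pdivrMr// ltr_pdivlMr//;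
    by rewrite [w * h]mulrC => /andP[? ?]; apply/andP; split; lra.
rewrite !lebesgue_measure_itv/= !lte_fin ltr_pM2r ?invr_gt0//.
rewrite ltrD2l ltrN2; case: ifP => _; last by rewrite mule0.
by rewrite -!EFinB -EFinM; congr EFin; field; rewrite gt_eqF.
Qed.

Lemma ge0_integral_reflect (h x : R) (f : R -> \bar R) : 0 < h ->
    measurable_fun setT f -> (forall y, 0 <= f y)%E ->
  (\int[mu]_y f y = h%:E * \int[mu]_w f (x - h * w)%R)%E.
Proof.
move=> h0 mf f0.
rewrite (eq_measure_integral (reflect_measure x h0)); last first.
  by move=> A mA _; exact: lebesgue_measure_reflect.
rewrite ge0_integral_mscale//=; congr (_ * _)%E.
rewrite ge0_integral_pushforward//; exact: measurable_reflect.
Qed.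

Lemma rintegrable_reflect (h x : R) f : 0 < h -> rintegrable f ->
  rintegrable (fun w => f (x - h * w)).
Proof.
move=> h0 /integrableP[mf intf].
apply/integrableP; split.
  by apply: measurableT_comp mf _; exact: measurable_reflect.
move: intf; rewrite (@ge0_integral_reflect h x)//; last exact: measurableT_comp.
rewrite /comp; case: (integral _ _ _) => [r _|/=|//]; first exact: ltry.
by rewrite gt0_muley.
Qed.

Lemma Rintegral_reflect (h x : R) f : 0 < h -> rintegrable f ->
  \int[mu]_y f y = h * \int[mu]_w f (x - h * w).
Proof.
move=> h0 intf.
have intfT := @rintegrable_reflect h x f h0 intf.
have mf := measurable_int _ intf.
suff fE : (\int[mu]_y (f y)%:E =
    h%:E * \int[mu]_w ((EFin \o (fun w => f (x - h * w)%R)) w))%E.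
  by rewrite /Rintegral fE fineM//; exact: integrable_fin_num intfT.
rewrite [LHS]integralE [X in _ = (_ * X)%E]integralE.
rewrite (muleBr (x := h%:E) _ (integrable_add_def measurableT intfT))//.
rewrite (@ge0_integral_reflect h x (EFin \o f)^\+%E)//; last first.
  exact: measurable_funepos.
rewrite (@ge0_integral_reflect h x (EFin \o f)^\-%E)//; last first.
  exact: measurable_funeneg.
by congr (_ * _ - _ * _)%E; apply: eq_integral => w _;
  rewrite ?funeposE ?funenegE.
Qed.

(** * Integrals of polynomials over oriented intervals *)

Lemma integrable_horner_itv (q : {poly R}) (A B : R) :
  mu.-integrable `[A, B] (EFin \o horner q).
Proof.
apply: continuous_compact_integrable; first exact: segment_compact.
by apply: continuous_subspaceT; exact: continuous_horner.
Qed.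

Lemma Rintegral_horner_itv (p : {poly R}) (A B : R) : A <= B ->
  \int[mu]_(x in `[A, B[) p^`().[x] = p.[B] - p.[A].
Proof.
move=> AB; rewrite Rintegral_itv_bndo_bndc; last first.
  by apply: integrableS (integrable_horner_itv _ A B) => //;
    exact: subset_itv_co_cc.
move: AB; rewrite le_eqVlt => /orP[/eqP->|AB].
  by rewrite set_itv1 Rintegral_set1 subrr.
rewrite /Rintegral (@continuous_FTC2 _ _ (horner p))//.
- by apply: continuous_subspaceT; exact: continuous_horner.
- split => [x _||]; first exact: derivable_horner.
  + by apply: cvg_at_right_filter; exact: continuous_horner.
  + by apply: cvg_at_left_filter; exact: continuous_horner.
- by move=> x _; rewrite derivE.
Qed.

Lemma oriented_itv_leE L y q : L <= y ->
  (fun x => oriented_itv L y x * q x) = q \_ `[L, y[.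
Proof.
move=> Ly; apply/funext => x; rewrite /oriented_itv patchE.
case: ifPn; rewrite ?notin_setE ?inE/= in_itv/=.
  by move=> /andP[Lx ->]; rewrite ltNge Lx subr0 mul1r.
case: (ltP x L) => [xL _|Lx]; first by rewrite (lt_le_trans xL)// subrr mul0r.
by move/negP; rewrite /= -leNgt ltNge => ->; rewrite subrr mul0r.
Qed.

Lemma oriented_itvC L y x : oriented_itv L y x = - oriented_itv y L x.
Proof. by rewrite /oriented_itv opprB. Qed.

Lemma Rintegral_oriented_itv (p : {poly R}) L y :
  rintegrable (fun x => oriented_itv L y x * p^`().[x]) /\
  \int[mu]_x (oriented_itv L y x * p^`().[x]) = p.[y] - p.[L].
Proof.
wlog Ly : L y / L <= y => [wlogLy|].
  have [Ly|/ltW yL] := leP L y; first exact: wlogLy.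
  have [intyL IyL] := wlogLy _ _ yL.
  have EN : (fun x => oriented_itv L y x * p^`().[x]) =
      (fun x => -1 * (oriented_itv y L x * p^`().[x])).
    by apply/funext => x; rewrite mulN1r oriented_itvC mulNr.
  rewrite EN; split; first exact: rintegrableZ.
  by rewrite RintegralZl// IyL mulN1r opprB.
have int : mu.-integrable `[L, y[ (EFin \o horner p^`()).
  by apply: integrableS (integrable_horner_itv _ L y) => //;
    exact: subset_itv_co_cc.
rewrite oriented_itv_leE//; split.
  by rewrite -restrict_EFin; apply/integrable_restrict; rewrite ?setTI.
by rewrite -Rintegral_mkcond Rintegral_horner_itv.
Qed.

End RealIntegration.

(** * Integrability and moments of B-splines *)

Section BsplineMoments.
Variable R : realType.
Implicit Types (v : nat -> R) (x y L : R).
Local Notation mu := (@lebesgue_measure R).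
Local Notation rintegrable f := (mu.-integrable setT (EFin \o f)).

Definition bounded_measurable (g : R -> R) : Prop :=
  measurable_fun setT g /\ exists M : R, forall x, `|g x| <= M.

Lemma bounded_measurableB (f g : R -> R) :
  bounded_measurable f -> bounded_measurable g ->
  bounded_measurable (fun x => f x - g x).
Proof.
move=> [mf [M fM]] [mg [N gN]]; split; first exact: measurable_funB.
by exists (M + N) => x; rewrite (le_trans (ler_normB _ _))// lerD.
Qed.

Lemma bounded_measurableZ (a : R) (f : R -> R) :
  bounded_measurable f -> bounded_measurable (fun x => a * f x).
Proof.
move=> [mf [M fM]]; split; first exact: measurable_funM.
by exists (`|a| * M) => x; rewrite normrM ler_wpM2l.
Qed.

Lemma rintegrable_bounded_measurableM (f g : R -> R) :
  bounded_measurable f -> rintegrable g -> rintegrable (fun x => f x * g x).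
Proof.
move=> [mf [M fM]] intg.
have bf : [bounded f x | x in [set: R]].
  exists M; split; first exact: num_real.
  by move=> N MN x _; apply: le_trans (fM x) _; exact: ltW.
exact: (@integrableMr _ _ _ mu setT measurableT f (EFin \o g) mf bf intg).
Qed.

Lemma bounded_measurable_jet_divdiff d v (K : R -> nat -> R -> R) :
    (forall j y, bounded_measurable (fun x => K x j y)) ->
  bounded_measurable (fun x => jet_divdiff d v (K x)).
Proof.
move=> bK; elim: d v => [|d IHd] v /=; first exact: bK.
case: (v 0%N == v d.+1).
  by under eq_fun do rewrite mulrC; exact: bounded_measurableZ.
by under eq_fun do rewrite mulrC;
  apply: bounded_measurableZ; exact: bounded_measurableB.
Qed.

Lemma Rintegral_jet_divdiff d v (K : R -> nat -> R -> R) :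
    (forall j y, rintegrable (fun x => K x j y)) ->
  rintegrable (fun x => jet_divdiff d v (K x)) /\
  \int[mu]_x jet_divdiff d v (K x) =
    jet_divdiff d v (fun j y => \int[mu]_x K x j y).
Proof.
move=> intK; elim: d v => [|d IHd] v /=; first by split => //; exact: intK.
case: (v 0%N == v d.+1).
  under [X in EFin \o X]eq_fun do rewrite mulrC.
  under eq_Rintegral do rewrite mulrC.
  by rewrite RintegralZl// mulrC; split => //; exact: rintegrableZ.
have [int1 I1] := IHd (knots_asc v 1).
have [int0 I0] := IHd v.
have intB : rintegrable (fun x => jet_divdiff d (knots_asc v 1) (K x) -
    jet_divdiff d v (K x)).
  under [X in EFin \o X]eq_fun do rewrite -mulN1r.
  by apply: rintegrableD => //; exact: rintegrableZ.
under [X in EFin \o X]eq_fun do rewrite mulrC.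
under eq_Rintegral do rewrite mulrC.
rewrite RintegralZl// RintegralB// I1 I0 mulrC; split => //.
exact: rintegrableZ.
Qed.

Lemma measurable_half_line y :
  measurable_fun setT (fun x => (x < y)%R%:R : R).
Proof.
rewrite (_ : (fun _ => _) = \1_`]-oo, y[)//; apply/funext => x.
rewrite indicE; congr (nat_of_bool _)%:R.
by apply/idP/idP; rewrite inE/= in_itv.
Qed.

Lemma bounded_measurable_kernel_jet k L j y :
  bounded_measurable (fun x => kernel_jet k L x j y).
Proof.
apply: bounded_measurableZ; split.
  apply: measurable_funM.
    by apply: measurable_funB; exact: measurable_half_line.
  by apply: measurable_funX; exact: measurable_funB.
exists (`|y - L| ^+ (k - j)) => x.
have yLk : 0 <= `|y - L| ^+ (k - j) by rewrite exprn_ge0.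
rewrite /oriented_itv normrM normrX.
have [xy|yx] := ltP x y; have [xL|Lx] := ltP x L;
  rewrite ?subrr ?normr0 ?mul0r// ?subr0 ?sub0r ?normrN normr1 mul1r;
  apply: lerXn2r; rewrite ?nnegrE//.
- by rewrite !ger0_norm; lra.
- by rewrite !ler0_norm; lra.
Qed.

Lemma bounded_measurable_bspline k v : knots_convex k.+1 v ->
  bounded_measurable (jet_bspline k v).
Proof.
move=> cv; rewrite (_ : jet_bspline k v =
  fun x => k.+1%:R * jet_divdiff k.+1 v (kernel_jet k 0 x)); last first.
  by apply/funext => x; exact: jet_bspline_kernel.
apply: bounded_measurableZ; apply: bounded_measurable_jet_divdiff => j y.
exact: bounded_measurable_kernel_jet.
Qed.

(** The Beta integral over an oriented interval from L to y, with an explicit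
    primitive, by integration by parts in the exponent m. *)
Lemma beta_primitive L y (m delta : nat) : exists2 p : {poly R},
    p^`() = (y%:P - 'X) ^+ m * ('X - L%:P) ^+ delta &
    p.[y] - p.[L] =
      (m`! * delta`!)%:R / (m + delta).+1`!%:R * (y - L) ^+ (m + delta).+1.
Proof.
elim: m delta => [|m IHm] delta.
  exists (delta.+1%:R^-1 *: ('X - L%:P) ^+ delta.+1).
    rewrite derivZ deriv_exp derivXsubC mul1r /= -scalerMnr scalerMnl.
    by rewrite -mulr_natr mulVf ?pnatr_eq0// scale1r.
  rewrite !hornerE subrr expr0n/= mulr0 subr0 factS natrM.
  by field; rewrite nat1r !pnatr_eq0 -lt0n fact_gt0.
have [q q' Iq] := IHm delta.+1.
exists (delta.+1%:R^-1 *: ((y%:P - 'X) ^+ m.+1 * ('X - L%:P) ^+ delta.+1 +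
  m.+1%:R *: q)).
  rewrite derivZ derivD derivM !deriv_exp derivXsubC derivB derivX derivC.
  rewrite derivZ q' /= sub0r scaler_nat.
  rewrite (_ : _ + _ + _ = (y%:P - 'X) ^+ m.+1 * ('X - L%:P) ^+ delta
    *+ delta.+1); last by ring.
  rewrite -scalerMnr scalerMnl.
  by rewrite -mulr_natr mulVf ?pnatr_eq0// scale1r.
have z n : (0 : R) ^+ n.+1 = 0 by rewrite exprS mul0r.
rewrite !(hornerZ, hornerD, hornerM, horner_exp, hornerN, hornerX, hornerC).
rewrite !subrr !z !mul0r !mulr0 !add0r -mulrBr -mulrBr Iq addnS.
rewrite addSn; move: ((m + delta).+2`!%:R^-1 : R) => c.
rewrite [m.+1`!]factS [delta.+1`!]factS !natrM.
by field; rewrite nat1r pnatr_eq0.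
Qed.

(** Cutting the truncated powers off at L turns the moment of the B-spline
    about L into a divided difference of Beta integrals, which are, up to the
    order k, the jet of a multiple of (y - L) ^+ (k + 1 + delta). *)
Lemma bspline_moment k v L delta : v 0%N != v k.+1 -> knots_convex k.+1 v ->
  rintegrable (fun x => jet_bspline k v x * (x - L) ^+ delta) /\
  \int[mu]_x (jet_bspline k v x * (x - L) ^+ delta) =
    jet_divdiff k.+1 v (pow_jet (k + 1 + delta) L) /
    'C(delta + k + 1, delta)%:R.
Proof.
move=> v0k cv.
pose K x j y := (x - L) ^+ delta * kernel_jet k L x j y.
have KE x : jet_bspline k v x * (x - L) ^+ delta =
    k.+1%:R * jet_divdiff k.+1 v (K x).
  by rewrite (jet_bspline_kernel L _ cv) /K jet_divdiffZ; ring.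
have intK j y : rintegrable (fun x => K x j y) /\
    \int[mu]_x K x j y = (k ^_ j)%:R *
      (((k - j)`! * delta`!)%:R / (k - j + delta).+1`!%:R *
       (y - L) ^+ (k - j + delta).+1).
  have [p p' Ip] := beta_primitive L y (k - j) delta.
  have [intp Intp] := Rintegral_oriented_itv p L y.
  have E x : K x j y = (k ^_ j)%:R * (oriented_itv L y x * p^`().[x]).
    rewrite p' hornerM !horner_exp !(hornerD, hornerN, hornerX, hornerC).
    by rewrite /K /kernel_jet; ring.
  under [X in EFin \o X]eq_fun do rewrite E.
  under eq_Rintegral do rewrite E.
  by rewrite RintegralZl// Intp Ip; split => //; exact: rintegrableZ.
have [intd Id] := Rintegral_jet_divdiff k.+1 v (fun j y => (intK j y).1).
under [X in EFin \o X]eq_fun do rewrite KE.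
under eq_Rintegral do rewrite KE.
rewrite RintegralZl// Id; split; first exact: rintegrableZ.
pose c : R := (k`! * delta`!)%:R / (k + delta).+1`!%:R.
rewrite (@eq_jet_divdiff_lt _ _ v _
    (fun j y => c * pow_jet (k + 1 + delta) L j y))//; last first.
  move=> j e jk ek; rewrite (intK j (v e)).2 /c /pow_jet.
  have -> : (k + 1 + delta - j = (k - j + delta).+1)%N by lia.
  rewrite -(@ffact_fact k j jk).
  have -> : ((k + delta).+1 = k + 1 + delta)%N by lia.
  have jkd : (j <= k + 1 + delta)%N by lia.
  have := fact_gt0 (k + 1 + delta); rewrite -(ffact_fact jkd) muln_gt0.
  have -> : (k + 1 + delta - j = (k - j + delta).+1)%N by lia.
  move: (_ ^+ _) (k ^_ j) (_ ^_ j) (k - j)`! (_.+1)`! => Y a b p q /andP[b0 q0].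
  rewrite !natrM.
  have {}b0 : b%:R != 0 :> R by rewrite pnatr_eq0 -lt0n.
  have {}q0 : q%:R != 0 :> R by rewrite pnatr_eq0 -lt0n.
  by field; rewrite q0 b0.
rewrite jet_divdiffZ mulrA mulrC; congr (_ * _).
have dk : (delta <= delta + k + 1)%N by lia.
have := fact_gt0 (delta + k + 1).
rewrite /c (_ : (k + delta).+1 = delta + k + 1)%N; last by lia.
rewrite -(bin_fact dk) (_ : delta + k + 1 - delta = k.+1)%N; last by lia.
rewrite factS !muln_gt0 => /and3P[b0 d0 /andP[_ k0]].
rewrite !natrM; set C := 'C(_, _).
have {}b0 : C%:R != 0 :> R by rewrite pnatr_eq0 -lt0n.
have {}d0 : delta`!%:R != 0 :> R by rewrite pnatr_eq0 -lt0n.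
have {}k0 : k`!%:R != 0 :> R by rewrite pnatr_eq0 -lt0n.
by field; rewrite nat1r b0 d0 k0 pnatr_eq0.
Qed.

End BsplineMoments.

(** * Reproduction determines the coefficients *)

Section KernelCoefficients.
Variable R : realType.
Local Notation mu := (@lebesgue_measure R).
Local Notation rintegrable f := (mu.-integrable setT (EFin \o f)).

Lemma knots_convex_mono d (v : nat -> R) :
  (forall i j, (i <= j)%N -> (j <= d)%N -> v i <= v j) -> knots_convex d v.
Proof.
move=> vmono i l e /andP[il le] ed vie; apply/eqP.
by rewrite eq_le {1}vie !vmono// (leq_trans le).
Qed.

Lemma knots_convex_affine d (v : nat -> R) (a b : R) : knots_convex d v ->
  knots_convex d (fun e => a * v e + b).
Proof.
have [->|a0] := eqVneq a 0; first by move=> _ i l e _ _; rewrite !mul0r.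
by move=> cv i l e ile ed /addIr/(mulfI a0)/(cv _ _ _ ile ed)->.
Qed.

Lemma finite_knots (T : nat -> R) N : finite_set (T @` `I_N).
Proof. by apply: finite_image; exact: finite_II. Qed.

Lemma off_knots (T : nat -> R) N x : ~ (T @` `I_N.+1) x ->
  forall i, (i <= N)%N -> x != T i.
Proof. by move=> TNx i iN; apply/eqP => xTi; apply: TNx; exists i. Qed.

Lemma repro_mxE k r (t : nat -> R) (J : 'I_r.+1 -> nat) delta c :
  repro_mx k t J delta c =
  jet_divdiff k.+1 (knots_asc t (J c)) (pow_jet (k + 1 + delta) 0).
Proof.
rewrite mxE divdiff_jet; apply: eq_jet_divdiff => // j e _ _.
rewrite -derive1n_shift_exp; congr (derive1n j _ _).
by apply/funext => y; rewrite subr0.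
Qed.

(** The kernel differs from a combination of everywhere defined B-splines at
    finitely many points only, so the moments of both about y agree. *)
Lemma siac_moments k r (J : 'I_r.+1 -> nat) (T : nat -> R) (f : R -> R)
    (coef : 'I_r.+1 -> R) (y : R) (delta : nat) :
    (forall c, J c <= J ord_max)%N ->
    (forall c, knots_convex k.+1 (knots_asc T (J c))) ->
    (forall c, T (J c) != T (J c + k + 1)%N) ->
    (forall x : R,
       (forall i, (i <= J ord_max + k + 1)%N -> x != T i) ->
       f x = \sum_(c < r.+1) coef c * bspline k (knots_asc T (J c)) x) ->
  convolution f (fun y => (- y) ^+ delta) y =
  \sum_(c < r.+1) coef c *
    (jet_divdiff k.+1 (knots_asc T (J c)) (pow_jet (k + 1 + delta) y) /
     'C(delta + k + 1, delta)%:R).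
Proof.
move=> leJ cT degT fE.
pose b c x := jet_bspline k (knots_asc T (J c)) x * (x - y) ^+ delta.
have bP c : rintegrable (b c) /\ \int[mu]_x b c x =
    jet_divdiff k.+1 (knots_asc T (J c)) (pow_jet (k + 1 + delta) y) /
    'C(delta + k + 1, delta)%:R.
  apply: bspline_moment => //.
  by rewrite /knots_asc addn0 addnS -addn1 -addnA addnA.
have intb : forall c, rintegrable (fun x => coef c * b c x).
  by move=> c; apply: rintegrableZ; exact: (bP c).1.
under eq_bigr do rewrite -(bP _).2 -RintegralZl ?(bP _).1//.
rewrite -Rintegral_sum//.
apply: (Rintegral_eq_off_finite (finite_knots T (J ord_max + k + 1).+1)) => //.
  by have /measurable_int/measurable_EFinP := rintegrable_sum intb.
move=> x /off_knots xT; rewrite fE// opprB mulr_suml; apply: eq_bigr => c _.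
rewrite -mulrA; congr (_ * (_ * _)); apply: bspline_off_knots => e ek.
by apply: xT; have := leJ c; lia.
Qed.

(** Knots that are an affine image of t turn the divided differences about
    x - h * lambda into h ^+ delta times the entries of the reproduction
    matrix of t. *)
Lemma kernel_coef_system k r (J : 'I_r.+1 -> nat) (t : nat -> R)
    (h x lambda : R) (f : R -> R) (coef : 'I_r.+1 -> R) (delta : 'I_r.+1) :
    0 < h -> (forall c, J c <= J ord_max)%N ->
    (forall c, knots_convex k.+1 (knots_asc t (J c))) ->
    (forall c, t (J c) != t (J c + k + 1)%N) ->
    (forall y : R,
       (forall i, (i <= J ord_max + k + 1)%N ->
          y != h * t i + x - h * lambda) ->
       f y = \sum_(c < r.+1) coef c *
         bspline k (knots_asc (fun i => h * t i + x - h * lambda) (J c)) y) ->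
    (forall y : R,
       convolution f (fun y => (- y) ^+ delta) y = (- y) ^+ delta) ->
  \sum_(c < r.+1) repro_mx k t J delta c * coef c =
  (-1) ^+ delta * 'C(delta + k + 1, delta)%:R * h ^- delta *
    (x - h * lambda) ^+ delta.
Proof.
move=> h0 leJ ct degt fE repro; have hn0 : h != 0 by rewrite gt_eqF.
set y := x - h * lambda; set C : R := 'C(_, _)%:R.
have C0 : C != 0.
  by rewrite pnatr_eq0 -lt0n bin_gt0 -addnA leq_addr.
have := repro y; rewrite (siac_moments _ _ leJ _ _ fE); first last.
- by move=> c; rewrite -!addrA (inj_eq (addIr _)) (inj_eq (mulfI hn0)).
- move=> c; have := @knots_convex_affine _ _ h (x - h * lambda) (ct c).
  by rewrite /knots_asc; under eq_fun do rewrite addrA.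
rewrite (exprNn y) => momy.
transitivity (C * h ^- delta * ((-1) ^+ delta * y ^+ delta)); last first.
  by rewrite mulrCA !mulrA.
rewrite -momy mulr_sumr; apply: eq_bigr => c _; rewrite repro_mxE -/C.
have -> : jet_divdiff k.+1
      (knots_asc (fun i => h * t i + x - h * lambda) (J c))
      (pow_jet (k + 1 + delta) y) =
    h ^+ delta *
      jet_divdiff k.+1 (knots_asc t (J c)) (pow_jet (k + 1 + delta) 0).
  rewrite (@eq_jet_divdiff _ _ _ (fun e => h * knots_asc t (J c) e + y) _
    (pow_jet (k + 1 + delta) y))//; last first.
    by move=> e _; rewrite /knots_asc /y addrA.
  rewrite jet_divdiff_affine//.
  rewrite (@eq_jet_divdiff_lt _ _ _ _ (fun j z => h ^+ (k + 1 + delta) *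
    pow_jet (k + 1 + delta) 0 j z)); last first.
  - move=> j e jk _; rewrite /pow_jet addrK subr0 exprMn !mulrA; congr (_ * _).
    by rewrite mulrAC -exprD subnKC//; lia.
  - by rewrite /knots_asc addn0 addnS -addn1 -addnA addnA.
  by rewrite jet_divdiffZ mulrA addn1 exprD mulKf ?expf_neq0.
have hd0 : h ^+ delta != 0 by rewrite expf_neq0.
by field; rewrite hd0 C0.
Qed.

(** If the system is solvable for every right-hand side of the form
    w delta * y ^+ delta, its solutions at r + 1 different y factor a
    Vandermonde matrix. *)
Lemma unitmx_moment_system r (M : 'M[R]_r.+1) (w : 'I_r.+1 -> R) :
    (forall i, w i != 0) ->
    (forall y : R, exists coef : 'I_r.+1 -> R,
       forall i, \sum_(c < r.+1) M i c * coef c = w i * y ^+ i) ->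
  M \in unitmx.
Proof.
move=> w0 /choice[C MC].
pose a : 'rV[R]_r.+1 := \row_i (i : nat)%:R.
have ME : M *m (\matrix_(c, i) C (a 0 i) c) =
    diag_mx (\row_i w i) *m Vandermonde r.+1 a.
  apply/matrixP => i j; rewrite mul_diag_mx !mxE.
  by rewrite -MC; apply: eq_bigr => c _; rewrite !mxE.
rewrite unitmxE unitfE; apply/eqP => detM.
have : \det (M *m (\matrix_(c, i) C (a 0 i) c)) != 0.
  rewrite ME det_mulmx det_diag det_Vandermonde mulf_neq0//.
    by apply/prodf_neq0 => i _; rewrite mxE.
  apply/prodf_neq0 => i _; apply/prodf_neq0 => j ij.
  by rewrite !mxE subr_eq0 eqr_nat gt_eqF.
by rewrite det_mulmx detM mul0r eqxx.
Qed.

End KernelCoefficients.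

(** * Filtering *)

Section Filtering.
Variable R : realType.
Local Notation mu := (@lebesgue_measure R).
Local Notation rintegrable f := (mu.-integrable setT (EFin \o f)).

(** Substituting y = x - h * w carries the B-splines over the knots
    x - h * v e to those over v, up to the factor h^-1 which the Jacobian h
    cancels, and u (x - y) to u (h * w), so that x remains in the
    coefficients only. *)
Lemma filter_substitution k N p m (v : 'I_p -> nat -> R) (V : nat -> R)
    (psi : 'I_m -> R -> R) (coef : 'I_p -> R) (q : 'I_m -> R) (h x : R)
    (f u : R -> R) :
    0 < h ->
    (forall c e, (e <= k.+1)%N -> exists2 i, (i <= N)%N & v c e = V i) ->
    (forall c, knots_convex k.+1 (v c)) ->
    (forall i, rintegrable (psi i)) ->
    (forall y, (forall i, (i <= N)%N -> y != x - h * V i) ->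
       f y = \sum_(c < p) coef c * bspline k (fun e => x - h * v c e) y) ->
    (forall w, u (h * w) = \sum_(i < m) q i * psi i w) ->
  convolution f u x =
  \sum_(c < p) coef c * \sum_(i < m) q i *
     \int[mu]_w (jet_bspline k (v c) w * psi i w).
Proof.
move=> h0 vV cv intpsi fE uE; have hn0 : h != 0 by rewrite gt_eqF.
pose T c e := x - h * v c e.
have cT c : knots_convex k.+1 (T c).
  have := @knots_convex_affine _ _ _ (- h) x (cv c).
  by rewrite /T; under eq_fun do rewrite addrC mulNr.
pose G y := \sum_(c < p) coef c * jet_bspline k (T c) y * u (x - y).
have intu : rintegrable (fun y => u (x - y)).
  pose g z := \sum_(i < m) q i * psi i z.
  have intg : rintegrable g.
    by apply: rintegrable_sum => i; apply: rintegrableZ.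
  have -> : (fun y => u (x - y)) = (fun y => g (x / h - h^-1 * y)).
    apply/funext => y; rewrite -[g _]uE; congr u; field.
    by rewrite hn0.
  by apply: rintegrable_reflect => //; rewrite invr_gt0.
have intG : rintegrable G.
  apply: rintegrable_sum => c; under [X in EFin \o X]eq_fun do rewrite -mulrA.
  apply: rintegrableZ; apply: rintegrable_bounded_measurableM => //.
  exact: bounded_measurable_bspline.
have -> : convolution f u x = \int[mu]_y G y.
  apply: (Rintegral_eq_off_finite
    (finite_knots (fun i => x - h * V i) N.+1)) => //.
    by have /measurable_int/measurable_EFinP := intG.
  move=> y /off_knots yV; rewrite fE// mulr_suml; apply: eq_bigr => c _.
  congr (_ * _ * _); apply: bspline_off_knots => e ek.
  by have [i iN ->] := vV c e ek; exact: yV.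
rewrite (Rintegral_reflect x h0 intG).
pose H w := \sum_(c < p) coef c * (\sum_(i < m) q i *
  (jet_bspline k (v c) w * psi i w)).
have intb c i : rintegrable (fun w => jet_bspline k (v c) w * psi i w).
  apply: rintegrable_bounded_measurableM => //.
  exact: bounded_measurable_bspline.
have intH1 c : rintegrable (fun w => \sum_(i < m) q i *
    (jet_bspline k (v c) w * psi i w)).
  by apply: rintegrable_sum => i; exact: rintegrableZ.
have intH : rintegrable H.
  by apply: rintegrable_sum => c; exact: rintegrableZ.
have -> : \int[mu]_w G (x - h * w) = \int[mu]_w (h^-1 * H w).
  apply: (Rintegral_eq_off_finite (finite_knots V N.+1)) => //.
    by have /measurable_int/measurable_EFinP := rintegrableZ h^-1 intH.
  move=> w /off_knots wV; rewrite /G /H subKr uE mulr_sumr.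
  apply: eq_bigr => c _; rewrite jet_bspline_reflect//; last first.
    by move=> e ek; have [i iN ->] := vV c e ek; exact: wV.
  transitivity (h^-1 * (coef c * (jet_bspline k (v c) w *
      \sum_(i < m) q i * psi i w))); first by ring.
  congr (_ * (_ * _)); rewrite mulr_sumr.
  by apply: eq_bigr => i _; rewrite [RHS]mulrCA.
rewrite RintegralZl// mulrA divff// mul1r Rintegral_sum; last first.
  by move=> c; exact: rintegrableZ.
apply: eq_bigr => c _; rewrite RintegralZl//; congr (_ * _).
rewrite Rintegral_sum; last by move=> i; exact: rintegrableZ.
by apply: eq_bigr => i _; rewrite RintegralZl.
Qed.

(** Off its knots, a B-spline vanishes outside any interval that contains them,
    and does not see the order in which they are listed. *)
Lemma Rintegral_bspline_support k (v : nat -> R) (psi : R -> R) (lo hi : R) :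
    knots_convex k.+1 v ->
    (forall e, (e <= k.+1)%N -> lo <= v e <= hi) ->
    rintegrable psi ->
  \int[mu]_(w in `[lo, hi]) (psi w * bspline k (fun e => v (k.+1 - e)%N) w) =
  \int[mu]_w (jet_bspline k v w * psi w).
Proof.
move=> cv vlohi intpsi; rewrite Rintegral_mkcond.
have intb : rintegrable (fun w => jet_bspline k v w * psi w).
  apply: rintegrable_bounded_measurableM => //.
  exact: bounded_measurable_bspline.
apply: (Rintegral_eq_off_finite (finite_knots v k.+2)) => //.
  by have /measurable_int/measurable_EFinP := intb.
move=> w /off_knots wv; rewrite patchE; case: ifPn.
  move=> _; rewrite bspline_off_knots ?jet_bspline_rev 1?mulrC// => e ek.
  by rewrite wv// leq_subr.
rewrite notin_setE/= in_itv/= => /negP wlh.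
by rewrite (jet_bspline_outside cv vlohi wlh) mul0r.
Qed.

Lemma Rintegral_bspline_disjoint k (v : nat -> R) (psi : R -> R) (lo hi : R) :
    knots_convex k.+1 v ->
    (forall e, (e <= k.+1)%N -> lo <= v e <= hi) ->
    (forall w, lo <= w <= hi -> psi w = 0) ->
  \int[mu]_w (jet_bspline k v w * psi w) = 0.
Proof.
move=> cv vlohi psi0; rewrite /Rintegral integral0_eq// => w _; congr EFin.
have [wlh|] := boolP (lo <= w <= hi); first by rewrite psi0// mulr0.
by move=> wlh; rewrite (jet_bspline_outside cv vlohi wlh) mul0r.
Qed.

Lemma rintegrable_of_support (phi : R -> R) (a b : R) :
    mu.-integrable `[a, b] (EFin \o phi) ->
    (forall x, ~~ (a <= x <= b) -> phi x = 0) ->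
  rintegrable phi.
Proof.
move=> intphi phi0.
have -> : EFin \o phi = (EFin \o phi) \_ `[a, b].
  apply/funext => x; rewrite patchE; case: ifPn => //.
  by rewrite notin_setE/= in_itv/= => /negP/phi0 /= ->.
by apply/integrable_restrict; rewrite ?setTI.
Qed.

Lemma reversal_mxE r (i j : 'I_r.+1) :
  reversal_mx R r i j = (i == rev_ord j)%:R.
Proof.
rewrite mxE; congr (nat_of_bool _)%:R; have jr := ltn_ord j.
by apply/eqP/eqP => [ij|->/=]; [apply/val_inj => /=|]; lia.
Qed.

(** The diagonal factors and the vector of powers of y multiply to M times the
    coefficient vector, which cancels the inverse of M. *)
Lemma filter_formE r m (I : {set 'I_m.+1}) (u : 'I_m.+1 -> R)
    (G : 'M[R]_(#|I|, r.+1)) (M : 'M[R]_r.+1) (d : 'rV[R]_r.+1)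
    (coef : 'I_r.+1 -> R) (h y : R) :
    M \in unitmx ->
    (forall l, \sum_(c < r.+1) M l c * coef c = d 0 l * h ^- l * y ^+ l) ->
  filter_form u (G *m reversal_mx R r *m invmx M *m diag_mx d) h y =
  \sum_(c < r.+1) coef c *
    \sum_(i < #|I|) u (enum_val i) * G i (rev_ord c).
Proof.
move=> uM Mcoef; rewrite /filter_form -!mulmxA.
set w := diag_mx d *m _.
have -> : w = M *m \col_c coef c.
  apply/colP => l; rewrite /w !mul_diag_mx !mxE.
  by rewrite mulrA -Mcoef; apply: eq_bigr => c _; rewrite !mxE.
rewrite mulKmx// !mulmxA mxE; apply: eq_bigr => c _.
rewrite [_ c 0]mxE mulrC; congr (_ * _).
rewrite mxE (bigD1 (rev_ord c))//= reversal_mxE eqxx mulr1.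
rewrite big1 ?addr0 => [|e ec]; last by rewrite reversal_mxE (negbTE ec) mulr0.
by rewrite mxE; apply: eq_bigr => i _; rewrite mxE.
Qed.

End Filtering.

(** * The filtered approximation *)

Lemma filter_form_poly (R : realType) r m (I : {set 'I_m.+1})
    (u : 'I_m.+1 -> R) (Q : 'M[R]_(#|I|, r.+1)) (h a : R) :
  exists2 p : {poly R}, (size p <= r.+1)%N &
    forall x, filter_form u Q h (x - a) = p.[x].
Proof.
pose B := (\row_(i < #|I|) u (enum_val i)) *m Q *m
  diag_mx (\row_(l < r.+1) h ^- l).
exists (\sum_(l < r.+1) B 0 l *: ('X - a%:P) ^+ l).
  apply: leq_trans (size_sum _ _ _) _; apply/bigmax_leqP => l _.
  by rewrite (leq_trans (size_scale_leq _ _))// size_exp_XsubC.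
move=> x; rewrite /filter_form -/B mxE horner_sum; apply: eq_bigr => l _.
by rewrite mxE hornerZ horner_exp hornerXsubC.
Qed.

Theorem theorem4p1 (R : realType) (k r m n : nat)
  (J : 'I_r.+1 -> nat)
  (hJ : forall c d : 'I_r.+1, (c < d)%N -> (J c < J d)%N)
  (hJ0 : J ord0 = 0%N)
  (hn : n = (J ord_max + k + 1)%N)
  (t : nat -> R)
  (ht : forall i j : nat, (i <= j)%N -> (j <= n)%N -> t i <= t j)
  (htJ : forall c : 'I_r.+1, t (J c) != t (J c + k + 1)%N)
  (h lambda a b : R) (hh : 0 < h)
  (s : 'I_m.+1 -> R)
  (hs : forall i j : 'I_m.+1, (i < j)%N -> s i < s j)
  (ha : a = h * s ord0) (hb : b = h * s ord_max)
  (phi : ('I_m.+1 -> R) -> 'I_m.+1 -> R -> R)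
  (hphi_indep : forall c : 'I_m.+1 -> R,
     (forall x : R, a <= x <= b ->
        \sum_(i < m.+1) c i * phi (fun p => h * s p) i x = 0) ->
     forall i : 'I_m.+1, c i = 0)
  (hphi_int : forall i : 'I_m.+1,
     (@lebesgue_measure R).-integrable `[a, b]
       (EFin \o phi (fun p => h * s p) i))
  (hphi_out : forall (i : 'I_m.+1) (x : R),
     ~~ (a <= x <= b) -> phi (fun p => h * s p) i x = 0)
  (hphi_scale : forall (i : 'I_m.+1) (x : R),
     phi (fun p => h * s p) i (h * x) = phi s i x)
  (u_ : 'I_m.+1 -> R -> R)
  (u : R -> R -> R)
  (hu : forall x tau : R, 0 <= tau ->
     u x tau = \sum_(i < m.+1) u_ i tau * phi (fun p => h * s p) i x)
  (f : R -> R -> R)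
  (hf : forall x : R,
     siac_kernel k J (fun i => h * t i + x - h * lambda) (f x)) :
  let I := overlapping (phi (fun p => h * s p))
             (h * (lambda - t n)) (h * (lambda - t 0%N)) in
  let Q := Q_mx k n lambda t (phi s) I J in
  forall tau : R, 0 <= tau ->
  [/\ exists2 p : {poly R}, (size p <= r.+1)%N &
        forall x : R, convolution (f x) (fun y => u y tau) x = p.[x],
      forall x : R, convolution (f x) (fun y => u y tau) x =
        filter_form (fun i => u_ i tau) (Q (reflect_index J)) h
          (x - h * lambda) &
      (forall c : 'I_r.+1, reflect_index J c = J c) ->
      forall x : R, convolution (f x) (fun y => u y tau) x =
        filter_form (fun i => u_ i tau) (Q J) h (x - h * lambda)].
Proof.
move=> I Q tau tau0.
have leJ c : (J c <= J ord_max)%N.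
  have [->//|cmax] := eqVneq c ord_max; apply/ltnW/hJ.
  by rewrite ltn_neqAle -ltnS ltn_ord andbT.
have ct c : knots_convex k.+1 (knots_asc t (J c)).
  apply: knots_convex_mono => i j ij jk; apply: ht; first by rewrite leq_add2l.
  by have := leJ c; lia.
have /choice[coef coefP] := hf.
pose d : 'rV[R]_r.+1 := \row_(l < r.+1) ((-1) ^+ l * 'C(l + k + 1, l)%:R).
have coefE x (l : 'I_r.+1) : \sum_(c < r.+1) repro_mx k t J l c * coef x c =
    d 0 l * h ^- l * (x - h * lambda) ^+ l.
  have [fE repro] := coefP x; rewrite mxE.
  apply: kernel_coef_system fE _ => // y.
  by apply: repro; rewrite -ltnS.
(* The coefficients exist for every x, i.e. for every y = x - h * lambda. *)
have uM : repro_mx k t J \in unitmx.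
  apply: (unitmx_moment_system (w := fun l => d 0 l * h ^- l)) => [l|y].
    apply: mulf_neq0; last by rewrite invr_eq0 expf_neq0// gt_eqF.
    by rewrite mxE mulf_neq0 ?signr_eq0// pnatr_eq0 -lt0n bin_gt0 -addnA
      leq_addr.
  exists (coef (y + h * lambda)) => l.
  by rewrite coefE addrK.
have intphi i : (@lebesgue_measure R).-integrable setT
    (EFin \o phi (fun p => h * s p) i).
  exact: rintegrable_of_support (hphi_int i) (hphi_out i).
have intpsi i : (@lebesgue_measure R).-integrable setT (EFin \o phi s i).
  (* The dilation w |-> h * w is a composition of two reflections. *)
  have -> : phi s i = fun w =>
      phi (fun p => h * s p) i (- (0 - h * w)).
    by apply/funext => w; rewrite sub0r opprK hphi_scale.
  apply: (@rintegrable_reflect _ h 0 (fun y => phi (fun p => h * s p) i (- y))).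
    exact: hh.
  have -> : (fun y => phi (fun p => h * s p) i (- y)) = fun y =>
      phi (fun p => h * s p) i (0 - 1 * y).
    by apply/funext => y; rewrite sub0r mul1r.
  exact: rintegrable_reflect.
pose v c e : R := lambda - t (J c + e)%N.
have cv c : knots_convex k.+1 (v c).
  have := @knots_convex_affine _ _ _ (-1) lambda (ct c).
  by rewrite /v; under eq_fun do rewrite mulN1r addrC.
have vD c e : (e <= k.+1)%N -> lambda - t n <= v c e <= lambda - t 0%N.
  move=> ek; have := leJ c; rewrite /v !lerD2l !lerN2 => Jc.
  by rewrite !ht//; lia.
have main x : convolution (f x) (fun y => u y tau) x =
    filter_form (fun i => u_ i tau) (Q (reflect_index J)) h (x - h * lambda).
  rewrite (filter_formE _ _ uM (coefE x)).
  rewrite (@filter_substitution _ k (J ord_max + k + 1) _ _ v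
    (fun i => lambda - t i) (phi s) (coef x) (fun i => u_ i tau) h)//.
  - apply: eq_bigr => c _; congr (_ * _).
    (* Basis functions outside I vanish where the B-splines do not. *)
    rewrite (bigID (mem I))/= addrC big1 ?add0r => [|i iI].
      rewrite big_enum_val; apply: eq_bigr => i _; congr (_ * _); rewrite mxE.
      rewrite -(Rintegral_bspline_support (cv c) (vD c) (intpsi _)).
      apply: eq_Rintegral => w _; congr (_ * _); apply: eq_bspline => e ek.
      rewrite /v /knots_desc /reflect_index rev_ordK; congr (_ - t _).
      by have := leJ c; lia.
    rewrite (Rintegral_bspline_disjoint (cv c) (vD c)) ?mulr0// => w wD.
    apply/eqP; apply: contraNT iI; rewrite -hphi_scale => phi0.
    rewrite inE; apply/asboolP; exists (h * w); split.
      exact: subset_closure.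
    by rewrite /= in_itv/= !ler_pM2l.
  - move=> c e ek; exists (J c + e)%N => //.
    by have := leJ c; lia.
  - move=> y yV; have [fE _] := coefP x; rewrite fE => [|i iN]; last first.
      by have := yV i iN; congr (_ != _); ring.
    apply: eq_bigr => c _; congr (_ * _); apply: eq_bspline => e _.
    by rewrite /knots_asc /v; ring.
  - by move=> w; rewrite hu//; apply: eq_bigr => i _; rewrite hphi_scale.
have [p sp pE] := filter_form_poly (fun i => u_ i tau) (Q (reflect_index J)) h
  (h * lambda).
split=> [||JE x]; first by exists p => // x; rewrite main pE.
  exact: main.
by rewrite main (_ : reflect_index J = J)//; exact/funext.
Qed.
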